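(* A countable non-exceptional semigroup $S$ of polynomials is amenable if and only if the following two conditions are satisfied: (a) $S$ does not contain free subsemigroups of rank $2$; (b) $S$ is cancellative.
   Context: A semigroup of polynomials is a non-empty family of non-constant complex polynomials closed under composition, with composition as product. A polynomial $Q$ is exceptional if $\deg(Q)\le1$, or $Q$ is affinely conjugate to $z^n$ or to a Chebyshev polynomial. A semigroup of polynomials is non-exceptional if it contains a non-exceptional polynomial. $L_\infty(S)$ is the space of bounded complex functions on $S$ with supremum norm; $(r_s\phi)(t)=\phi(ts)$, $(l_s\phi)(t)=\phi(st)$. A mean is a positive continuous linear functional $M$ on $L_\infty(S)$ with $M(1)=1$. $RIM(S)$ (resp. $LIM(S)$) is the set of means invariant under all $r_s$ (resp. all $l_s$), $s\in S$. $S$ is amenable if $RIM(S)\cap LIM(S)\ne\emptyset$. $S$ is cancellative if each of $ab=ac$ and $ba=ca$ implies $b=c$, for all $a,b,c\in S$. *)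

(* Defs.v *)
From HB Require Import structures.
From mathcomp Require Import all_boot all_order all_algebra.
From mathcomp Require Import all_classical all_reals all_analysis.
From mathcomp Require Import complex.

Set Implicit Arguments.
Unset Strict Implicit.
Unset Printing Implicit Defensive.
Import Order.TTheory GRing.Theory Num.Theory.
Import numFieldNormedType.Exports.

Local Open Scope classical_set_scope.
Local Open Scope ring_scope.

(* The complex numbers are R[i], for R a realType. *)
Section Linf.
Variables (R : realType) (T : Type).
Local Notation C := R[i].

Definition bounded_pred : {pred T -> C^o} :=
  mem (bounded_fun : set (T -> C^o)).

Record Linf := MkLinf {
  Linf_fun :> T -> C^o;
  Linf_bounded : Linf_fun \in bounded_pred }.

HB.instance Definition _ := [isSub for Linf_fun].
HB.instance Definition _ := [Choice of Linf by <:].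

Lemma bounded_funP (f : T -> C^o) :
  f \in bounded_pred <-> exists M : C, forall t, `|f t| <= M.
Proof.
rewrite inE; split=> [[M [Mr fM]]|[M fM]].
  exists (M + 1) => t; apply: fM => //; by rewrite ltrDl.
have [[t0]|T0] := pselect (inhabited T); last first.
  by exists 0; split=> // x _ t; case: T0; exact: inhabits.
exists M; split; first exact/ger0_real/(le_trans (normr_ge0 _) (fM t0)).
by move=> x Mx t _; exact: le_trans (fM t) (ltW Mx).
Qed.

Lemma bounded_fun_submod_closed :
  submod_closed bounded_pred.
Proof.
split; first by apply/bounded_funP; exists 0 => t; rewrite normr0.
move=> a f g /bounded_funP[M fM] /bounded_funP[N gN].
apply/bounded_funP; exists (`|a| * M + N) => t.
apply: (le_trans (ler_normD _ _)); apply: lerD (gN t).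
by rewrite normrZ ler_wpM2l.
Qed.

HB.instance Definition _ := GRing.isSubmodClosed.Build C (T -> C^o)
  bounded_pred bounded_fun_submod_closed.
HB.instance Definition _ := [SubChoice_isSubLmodule of Linf by <:].

Lemma Linf_bound (f : Linf) : exists M : C, forall t, `|f t| <= M.
Proof. exact/bounded_funP/Linf_bounded. Qed.

(* The supremum norm; sup is taken in R, and is 0 when T is empty. *)
Definition Linf_norm (f : Linf) : C :=
  (sup [set complex.Re `|f t| | t in [set: T]])%:C%C.

Lemma Linf_le_norm (f : Linf) t : `|f t| <= Linf_norm f.
Proof.
have ReK z : `|z : C^o| = (complex.Re `|z|)%:C%C.
  by rewrite normc_def.
rewrite ReK lecR; apply: ub_le_sup; last by exists t.
have [M fM] := Linf_bound f.
exists (complex.Re M) => _ [u _ <-].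
by have := fM u; rewrite ReK; case: (M) => x y /= /andP[].
Qed.

Lemma Linf_norm_le (f : Linf) (M : C) :
  0 <= M -> (forall t, `|f t| <= M) -> Linf_norm f <= M.
Proof.
move=> M0 fM.
have ME : M = (complex.Re M)%:C%C.
  by case: M M0 {fM} => x y; rewrite lecE /= => /andP[/eqP-> _].
have ReK z : `|z : C^o| = (complex.Re `|z|)%:C%C by rewrite normc_def.
rewrite ME lecR.
have [[t0]|T0] := pselect (inhabited T); last first.
  rewrite (_ : [set _ | _ in _] = set0) ?sup0; first by rewrite -lecR -ME.
  by rewrite -subset0 => u [t _ _]; case: T0; exact: inhabits.
apply: ge_sup; first by exists (complex.Re `|f t0|), t0.
by move=> _ [u _ <-]; rewrite -lecR -ME -ReK.
Qed.

Lemma Linf_norm_ge0 (f : Linf) : 0 <= Linf_norm f.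
Proof.
have [[t0]|T0] := pselect (inhabited T).
  exact: le_trans (normr_ge0 _) (Linf_le_norm f t0).
rewrite /Linf_norm (_ : [set _ | _ in _] = set0) ?sup0 //.
by rewrite -subset0 => u [t _ _]; case: T0; exact: inhabits.
Qed.

Lemma Linf_ler_normD (f g : Linf) :
  Linf_norm (f + g) <= Linf_norm f + Linf_norm g.
Proof.
apply: Linf_norm_le => [|t]; first by rewrite addr_ge0 ?Linf_norm_ge0.
by apply: (le_trans (ler_normD _ _)); rewrite lerD ?Linf_le_norm.
Qed.

Lemma Linf_normrZ (a : C) (f : Linf) :
  Linf_norm (a *: f) = `|a| * Linf_norm f.
Proof.
have le b (g : Linf) : Linf_norm (b *: g) <= `|b| * Linf_norm g.
  apply: Linf_norm_le => [|t]; first by rewrite mulr_ge0 ?Linf_norm_ge0.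
  by rewrite normrZ ler_wpM2l ?Linf_le_norm.
apply/eqP; rewrite eq_le le /=.
have [->|a0] := eqVneq a 0; first by rewrite normr0 mul0r Linf_norm_ge0.
rewrite -ler_pdivlMl ?normr_gt0 // -normfV.
by rewrite -{1}[f](scalerK a0) le.
Qed.

Lemma Linf_normr0_eq0 (f : Linf) : Linf_norm f = 0 -> f = 0.
Proof.
move=> f0; apply/val_inj/funext => t; apply/eqP.
by rewrite -normr_le0 -[leRHS]f0 Linf_le_norm.
Qed.

HB.instance Definition _ := Lmodule_isNormed.Build C Linf
  Linf_ler_normD Linf_normrZ Linf_normr0_eq0.

Lemma cst_bounded (c : C) : (fun=> c) \in bounded_pred.
Proof. by apply/bounded_funP; exists `|c|. Qed.

Definition Linf_cst (c : C) : Linf := MkLinf (cst_bounded c).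

Lemma Linf_comp_bounded (g : T -> T) (f : Linf) :
  f \o g \in bounded_pred.
Proof. by apply/bounded_funP; have [M fM] := Linf_bound f; exists M => t /=. Qed.

Definition is_mean (M : {linear Linf -> C^o}) : Prop :=
  [/\ continuous M,
      forall f : Linf, (forall t, 0 <= f t :> C) -> 0 <= M f :> C
    & M (Linf_cst 1) = 1].

End Linf.

Section Semigroup.
Variables (R : realType) (S : semigroupType).
Local Notation C := R[i].
Local Notation Linf := (Linf R S).

Definition rtrans (s : S) (f : Linf) : Linf :=
  MkLinf (Linf_comp_bounded (fun t => t * s)%g f).

Definition ltrans (s : S) (f : Linf) : Linf :=
  MkLinf (Linf_comp_bounded (fun t => s * t)%g f).

Definition RIM : set {linear Linf -> C^o} :=
  [set M | is_mean M /\ forall s f, M (rtrans s f) = M f].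

Definition LIM : set {linear Linf -> C^o} :=
  [set M | is_mean M /\ forall s f, M (ltrans s f) = M f].

Definition amenable : Prop := RIM `&` LIM !=set0.

End Semigroup.

Definition cancellative (S : semigroupType) : Prop :=
  forall a b c : S, ((a * b = a * c)%g -> b = c) /\ ((b * a = c * a)%g -> b = c).

Section FreeSemigroup.
Variable X : choiceType.

Record free_semigroup := FreeWord {
  word :> seq X;
  word_neq0 : word != [::] }.

HB.instance Definition _ := [isSub for word].
HB.instance Definition _ := [Choice of free_semigroup by <:].

Lemma cat_word_neq0 (u v : free_semigroup) : word u ++ word v != [::].
Proof. by case: u => -[]. Qed.

Definition cat_word (u v : free_semigroup) := FreeWord (cat_word_neq0 u v).

Lemma cat_wordA : associative cat_word.
Proof. by move=> u v w; apply: val_inj; rewrite /= catA. Qed.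

HB.instance Definition _ := isSemigroup.Build free_semigroup cat_wordA.

End FreeSemigroup.

(* A free subsemigroup of rank n is the image of an injective morphism from the
   free semigroup on n letters. *)
Definition contains_free (n : nat) (S : semigroupType) : Prop :=
  exists f : {multiplicative free_semigroup 'I_n -> S}, injective f.

Section Polynomials.
Variable R : realType.
Local Notation C := R[i].
Implicit Types P Q : {poly C}.

Record poly_semigroup := PolySemigroup {
  psg_set :> set {poly C};
  psg_nonempty : psg_set !=set0;
  psg_nonconstant : forall P, psg_set P -> (1 < size P)%N;
  psg_comp : forall P Q, psg_set P -> psg_set Q -> psg_set (P \Po Q) }.

Definition psg_elt (S : poly_semigroup) : Type := {P : {poly C} | P \in psg_set S}.

Section Elt.
Variable S : poly_semigroup.

HB.instance Definition _ := SubChoice.on (psg_elt S).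

Lemma psg_mul_subproof (P Q : psg_elt S) : val P \Po val Q \in psg_set S.
Proof.
by apply/mem_set/psg_comp; apply/set_mem; apply: valP.
Qed.

Definition psg_mul (P Q : psg_elt S) : psg_elt S :=
  exist _ (val P \Po val Q) (psg_mul_subproof P Q).

Lemma psg_mulA : associative psg_mul.
Proof. by move=> P Q U; apply: val_inj; rewrite /= comp_polyA. Qed.

HB.instance Definition _ := isSemigroup.Build (psg_elt S) psg_mulA.

End Elt.

(* First kind, normalised by T_n(cos t) = cos (n t). No sign is allowed: T_n and
   - T_n are affinely conjugate for n even, but not for n odd, n >= 3. *)
Fixpoint chebyshevT (n : nat) : {poly C} :=
  match n with
  | 0 => 1
  | n'.+1 => if n' is n''.+1 then 'X * chebyshevT n' *+ 2 - chebyshevT n'' else 'X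
  end.

(* Q = A^-1 o P o A for an affine bijection A. *)
Definition affine_conjugate P Q : Prop :=
  exists2 A : {poly C}, size A = 2%N & A \Po Q = P \Po A.

Definition exceptional Q : Prop :=
  [\/ (size Q <= 2)%N,
      exists n, affine_conjugate 'X^n Q
    | exists n, affine_conjugate (chebyshevT n) Q].

Definition nonexceptional (S : poly_semigroup) : Prop :=
  exists2 P, psg_set S P & ~ exceptional P.

End Polynomials.

(* Main.v *)
Require Import Defs.
From HB Require Import structures.
From mathcomp Require Import all_boot all_order all_algebra.
From mathcomp Require Import all_classical all_reals all_analysis.
From mathcomp Require Import complex zify ring lra.

(** The proof compares elements of S of equal degree.

    Suppose any two elements a, b of S have a common left multiple
    x o a = y o b. When deg a = deg b, the top coefficients of the common value
    determine its inner factor up to an affine map, so b = k o a with k affine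
    ([left_multiple_affine]). If P is in S, then P o a and P o b have equal
    degree as well, so k is an affine symmetry of P: P o k = v o P with v
    affine, and v is again a symmetry of P. A polynomial of degree at least 2
    that is not affinely conjugate to a power z^n has finitely many such k
    ([finite_symmetries]). Hence, for a constant r, every degree is shared by at
    most r elements of S ([psg_degree_fibers]). Both directions of the
    equivalence supply common left multiples, and then use the bound r.

    If S is amenable, an invariant mean gives mass 1 to every Sa and every aS,
    so S has common left and common right multiples. Free subsemigroups of rank
    2 are impossible: the r + 1 words a^i b a^(r - i) would be distinct elements
    of one degree ([bounded_fibers_no_free]). Right cancellation is automatic
    for non-constant polynomials; left cancellation ([psg_cancellative]) comes
    from an element s of S that every one of the finitely many symmetries k with
    t o k = t for some t in S also fixes: s o k = s.

    Conversely, two elements without common left multiple freely generate a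
    free subsemigroup, so condition (a) yields common left multiples
    ([no_free_common_left_multiples]) and therefore the bound r. Degrees are
    multiplicative, so the words of length at most n in finitely many elements
    take polynomially many degrees, and polynomially many values
    ([size_cayley_ball]). Some large ball is then almost as big as the next one
    ([polynomial_growth_ratio]). In a cancellative semigroup translations on
    both sides are injective, and translations by generators move a ball into
    the next one, so averages over such balls are asymptotically invariant, and
    their limit along an ultrafilter is a two-sided invariant mean
    ([folner_amenable]). *)

Set Implicit Arguments.
Unset Strict Implicit.
Unset Printing Implicit Defensive.
Import Order.TTheory GRing.Theory Num.Theory.
Import numFieldNormedType.Exports.
Local Open Scope classical_set_scope.
Local Open Scope ring_scope.

(** * Affine ambiguity of decompositions of polynomials *)

Section Decompositions.
Variable F : numFieldType.
Implicit Types (A B K L P V X Y : {poly F}) (a b c t : F).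

Lemma coef_exp_top A m : (A ^+ m)`_((size A).-1 * m) = lead_coef A ^+ m.
Proof. by rewrite -lead_coef_exp lead_coefE size_exp. Qed.

(** In A^m - B^m = (A - B) (A^(m-1) + ... + B^(m-1)), the terms of the second
    factor all have the same leading monomial, and in characteristic zero these
    do not cancel. *)
Lemma size_subXX A B m : (0 < m)%N -> A != B -> size A = size B ->
  lead_coef A = lead_coef B ->
  ((size A).-1 * m.-1 < size (A ^+ m - B ^+ m)%R)%N.
Proof.
move=> m0 AB sAB lAB.
have A0 : A != 0.
  apply: contraNneq AB => A0; move/eqP: sAB.
  by rewrite A0 size_poly0 eq_sym size_poly_eq0 eq_sym.
have B0 : B != 0 by rewrite -size_poly_eq0 -sAB size_poly_eq0.
rewrite subrXX; set G := \sum_(i < m) _.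
suff sG : ((size A).-1 * m.-1 < size G)%N.
  have AB0 : (0 < size (A - B)%R)%N by rewrite size_poly_gt0 subr_eq0.
  rewrite size_mul -?size_poly_gt0 //; last exact: leq_ltn_trans sG.
  apply: leq_trans sG _.
  by case: (size (A - B)%R) AB0 => // k _; rewrite addSn leq_addl.
rewrite ltnNge; apply/negP => /leq_sizeP/(_ _ (leqnn _)).
have -> : G`_((size A).-1 * m.-1) = lead_coef A ^+ m.-1 *+ m.
  rewrite coef_sum (eq_bigr (fun=> lead_coef A ^+ m.-1)).
    by rewrite sumr_const card_ord.
  move=> i _.
  have im := ltn_ord i.
  have <- : lead_coef (A ^+ (m.-1 - i) * B ^+ i) = lead_coef A ^+ m.-1.
    by rewrite lead_coefM !lead_coef_exp -lAB -exprD; congr (_ ^+ _); lia.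
  rewrite lead_coefE; congr (_`_ _).
  have im' : m.-1 = (m.-1 - i + i)%N by lia.
  rewrite size_mul ?expf_neq0 // [in LHS]im' mulnDr -size_exp sAB -size_exp.
  have : (0 < size (A ^+ (m.-1 - i))%R)%N by rewrite size_poly_gt0 expf_neq0.
  have : (0 < size (B ^+ i)%R)%N by rewrite size_poly_gt0 expf_neq0.
  by case: (size _) => // u _; case: (size _) => // v _; rewrite addnS /= addnC.
by apply/eqP; rewrite mulrn_eq0 negb_or -lt0n m0 expf_neq0 ?lead_coef_eq0.
Qed.

(** Uniqueness of the polynomial part of an m-th root: up to an error of degree
    below (m - 1)d, a polynomial of degree md is a multiple of the m-th power of
    at most one polynomial of degree d, up to a scalar. Otherwise [size_subXX]
    makes the difference of the two powers too large. *)
Lemma approx_root_unique A B L1 L2 c1 c2 m : (0 < m)%N -> c1 != 0 ->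
  size A = size B -> (1 < size A)%N ->
  (size L1 <= (size A).-1 * m.-1)%N -> (size L2 <= (size A).-1 * m.-1)%N ->
  c1 *: A ^+ m + L1 = c2 *: B ^+ m + L2 ->
  A = (lead_coef A / lead_coef B) *: B.
Proof.
move=> m0 c10 sAB sA sL1 sL2 E.
have B0 : lead_coef B != 0 by rewrite lead_coef_eq0 -size_poly_gt0 -sAB; lia.
have A0 : lead_coef A != 0 by rewrite lead_coef_eq0 -size_poly_gt0; lia.
set r := _ / _.
have r0 : r != 0 by rewrite mulf_neq0 ?invr_eq0.
have sAm : ((size A).-1 * m.-1 <= (size A).-1 * m)%N by nia.
have lead : c1 * lead_coef A ^+ m = c2 * lead_coef B ^+ m.
  have := congr1 (fun p : {poly F} => p`_((size A).-1 * m)) E.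
  rewrite !coefD !coefZ coef_exp_top sAB coef_exp_top -sAB.
  by rewrite !nth_default ?addr0 //; apply: leq_trans sAm.
(* Rescaling B by r matches the leading coefficients and turns c2 into c1. *)
have c2E : c2 = c1 * r ^+ m.
  apply: (mulIf (expf_neq0 m B0)); rewrite -lead -mulrA -exprMn.
  by rewrite /r divfK.
apply/eqP; apply: contraT => AB.
have := size_subXX m0 AB; rewrite size_scale // => /(_ sAB).
rewrite lead_coefZ /r divfK // => /(_ erefl); rewrite -/r.
rewrite ltnNge => /negP[]; rewrite -(size_scale _ c10).
have -> : c1 *: (A ^+ m - (r *: B) ^+ m) = L2 - L1.
  rewrite exprZn scalerBr scalerA -c2E.
  by apply/eqP; rewrite subr_eq addrAC eq_sym subr_eq E addrC.
by apply: leq_trans (size_polyD _ _) _; rewrite size_polyN geq_max sL1 sL2.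
Qed.

Lemma exp_XaddC t n : exists2 L : {poly F}, (size L <= n)%N &
  ('X + t%:P) ^+ n.+1 = ('X^(n.+1) + (t *+ n.+1) *: 'X^n + L)%R.
Proof.
elim: n => [|n [L sL E]].
  by exists 0; rewrite ?size_poly0 // !expr1 mulr1n expr0 alg_polyC addr0.
exists ((t ^+ 2 *+ n.+1) *: 'X^n + L * ('X + t%:P)).
  apply: leq_trans (size_polyD _ _) _; rewrite geq_max.
  rewrite (leq_trans (size_scale_leq _ _)) ?size_polyXn //=.
  apply: leq_trans (size_polyMleq _ _) _.
  by rewrite size_XaddC addn2.
rewrite exprS E -!mul_polyC !polyCMn polyC_exp !(exprS 'X).
rewrite -[t%:P *+ n.+1]mulr_natr -(mulr_natr _ n.+2).
rewrite -[t%:P ^+ 2 *+ _]mulr_natr -(@natr1 _ n.+1).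
by move: n.+1%:R t%:P => k T; ring.
Qed.

(** Completing the m-th power removes the coefficient of degree m - 1. This is
    what makes the error small enough for [approx_root_unique]. *)
Lemma depressed_form X m : size X = m.+1 -> (0 < m)%N ->
  exists t L, X = lead_coef X *: ('X + t%:P) ^+ m + L /\ (size L <= m.-1)%N.
Proof.
case: m => // n sX _ /=.
have l0 : lead_coef X != 0 by rewrite lead_coef_eq0 -size_poly_gt0 sX.
pose t := X`_n / (lead_coef X * n.+1%:R).
exists t, (X - lead_coef X *: ('X + t%:P) ^+ n.+1).
split; first by rewrite addrC subrK.
have [L sL EL] := exp_XaddC t n.
apply/leq_sizeP => j; rewrite leq_eqVlt => /predU1P[<-|nj].
  rewrite EL coefB coefZ !coefD coefZ !coefXn eqxx ltn_eqF //= add0r mulr1.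
  rewrite (nth_default _ sL) addr0 -[t *+ _]mulr_natr mulrCA.
  by rewrite /t divfK ?subrr // mulf_neq0 // pnatr_eq0.
rewrite EL coefB coefZ !coefD coefZ !coefXn.
rewrite (nth_default _ (leq_trans sL (ltnW nj))) addr0 (gtn_eqF nj) mulr0 addr0.
move: nj; rewrite leq_eqVlt => /predU1P[<-|nj]; last first.
  by rewrite gtn_eqF // mulr0 subr0 nth_default // sX.
by rewrite eqxx mulr1 lead_coefE sX subrr.
Qed.

Lemma comp_polyXe A B m : (A ^+ m) \Po B = (A \Po B) ^+ m.
Proof. exact: (rmorphXn (comp_poly B)). Qed.

Lemma comp_poly_inj A : (1 < size A)%N -> injective (comp_poly A).
Proof.
move=> sA X Y E; apply/eqP; rewrite -subr_eq0.
by rewrite -(comp_poly_eq0 _ sA) comp_polyB E subrr.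
Qed.

Lemma affineP K : size K = 2 -> exists a b, a != 0 /\ K = a *: 'X + b%:P.
Proof.
move=> sK; exists K`_1, K`_0; split.
  have := lead_coef_eq0 K; rewrite lead_coefE sK /= => ->.
  by rewrite -size_poly_eq0 sK.
apply/polyP => -[|[|i]]; rewrite coefD coefZ coefX coefC /=.
- by rewrite mulr0 add0r.
- by rewrite mulr1 addr0.
- by rewrite mulr0 addr0 nth_default // sK.
Qed.

Lemma size_affine a b : a != 0 -> size (a *: 'X + b%:P) = 2.
Proof.
move=> a0; rewrite size_polyDl size_scale ?size_polyX //.
by rewrite size_polyC; case: (b != 0).
Qed.

Lemma size_comp_le L A m : (1 < m)%N -> (1 < size A)%N -> (size L <= m.-1)%N ->
  (size (L \Po A) <= (size A).-1 * m.-1)%N.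
Proof.
move=> m1 sA sL; apply: leq_trans (size_comp_poly_leq _ _) _.
by nia.
Qed.

(** Depressing X and Y exhibits both A and B, up to translation, as approximate
    roots of the same polynomial. *)
Lemma left_multiple_affine X Y A B : (1 < size X)%N -> size A = size B ->
  (1 < size A)%N -> X \Po A = Y \Po B ->
  exists2 K : {poly F}, size K = 2 & B = K \Po A.
Proof.
move=> sX sAB sA E.
have sB : (1 < size B)%N by rewrite -sAB.
have sXY : size Y = size X.
  have := congr1 (fun p : {poly F} => (size p).-1) E => /=.
  rewrite !size_comp_poly -sAB => /eqP; rewrite eqn_mul2r; case/orP.
    by case: (size A) sA => [|[|?]].
  case: (size X) sX => [|[|x]] // _; case: (size Y) => [|y] //=.
  by move=> /eqP ->.
have [m m0 sXm] : exists2 m, (0 < m)%N & size X = m.+1.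
  by exists (size X).-1; lia.
have [t [L1 [EX sL1]]] := depressed_form sXm m0.
have [u [L2 [EY sL2]]] := depressed_form (etrans sXY sXm) m0.
have X0 : lead_coef X != 0 by rewrite lead_coef_eq0 -size_poly_gt0; lia.
have sAt (C : {poly F}) s : (1 < size C)%N -> size (C + s%:P) = size C.
  move=> sC; rewrite size_polyDl // (leq_ltn_trans (size_polyC_leq1 _)) //.
have sL (L C : {poly F}) : (1 < size C)%N -> (size L <= m.-1)%N ->
    (size (L \Po C) <= (size C).-1 * m.-1)%N.
  move=> sC; case: m m0 {sXm EX EY sL1 sL2} => [|[|m]] // _.
    by rewrite size_poly_leq0 => /eqP ->; rewrite comp_poly0 size_poly0.
  exact: size_comp_le.
have /(approx_root_unique m0 X0) : lead_coef X *: (A + t%:P) ^+ m + (L1 \Po A)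
    = lead_coef Y *: (B + u%:P) ^+ m + (L2 \Po B).
  have comp (C L : {poly F}) c s : (c *: ('X + s%:P) ^+ m + L) \Po C =
      c *: (C + s%:P) ^+ m + (L \Po C).
    by rewrite comp_polyD comp_polyZ comp_polyXe comp_polyD comp_polyX comp_polyC.
  by rewrite -!comp -EX -EY.
rewrite !sAt // => /(_ sAB sA (sL _ _ sA sL1)).
rewrite sAB => /(_ (sL _ _ sB sL2)); set r := _ / _ => Er.
have r0 : r != 0.
  apply: contraTneq sA => r0; move: (sAt A t); rewrite Er r0 scale0r size_poly0.
  by case: (size A) => // -[|k] // /(_ isT).
exists (r^-1 *: 'X + (r^-1 * t - u)%:P); first by rewrite size_affine ?invr_eq0.
rewrite comp_polyD comp_polyZ comp_polyX comp_polyC.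
rewrite polyCB addrA polyCM mul_polyC -scalerDr Er scalerA mulVf // scale1r.
by rewrite addrK.
Qed.

(** The centre - t of P is intrinsic, so a symmetry K must fix it: both sides of
    P o K = V o P are approximate n-th powers, of K + t on one side and of
    'X + t on the other. *)
Lemma symmetry_center P t L c n K V : c != 0 -> (1 < n)%N ->
  P = c *: ('X + t%:P) ^+ n + L -> (size L <= n.-1)%N ->
  size K = 2 -> size V = 2 -> P \Po K = V \Po P ->
  exists2 a, a != 0 & K = a *: ('X + t%:P) - t%:P.
Proof.
move=> c0 n1 EP sL sK sV.
have [v [w [v0 ->]]] := affineP sV.
have [a [b [a0 EK]]] := affineP sK.
rewrite [in RHS]comp_polyD comp_polyZ comp_polyX comp_polyC {}EP.
rewrite [in LHS]comp_polyD comp_polyZ comp_polyXe comp_polyD comp_polyX comp_polyC.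
rewrite scalerDr scalerA -addrA => E.
have sKt : size (K + t%:P) = 2.
  by rewrite EK -addrA -polyCD size_affine.
have n0 : (0 < n)%N by lia.
have sVL : (size (v *: L + w%:P)%R <= n.-1)%N.
  apply: leq_trans (size_polyD _ _) _; rewrite geq_max size_scale // sL /=.
  by apply: leq_trans (size_polyC_leq1 _) _; lia.
have := approx_root_unique n0 c0 _ _ _ _ E.
rewrite sKt size_XaddC mul1n => /(_ erefl isT _ sVL).
have -> : (size (L \Po K) <= n.-1)%N by rewrite size_comp_poly2.
move=> /(_ isT); rewrite lead_coefXaddC divr1; set l := lead_coef _ => El.
exists l; last by rewrite -El addrK.
by rewrite lead_coef_eq0 -size_poly_eq0 sKt.
Qed.

Lemma coef_comp_scaleX P a j : (P \Po (a *: 'X))`_j = P`_j * a ^+ j.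
Proof.
rewrite comp_polyE (eq_bigr (fun i : 'I_(size P) => (P`_i * a ^+ i) *: 'X^i)).
  rewrite -(poly_def _ (fun i => P`_i * a ^+ i)) coef_poly.
  by case: ltnP => // sPj; rewrite nth_default // mul0r.
by move=> i _; rewrite exprZn scalerA.
Qed.

End Decompositions.

(** * Finiteness of affine symmetries *)

Section Symmetries.
Variable F : numClosedFieldType.
Implicit Types (K V W P : {poly F}).

(** In the coordinate centred at - t, a symmetry is a scaling by some a. If P
    has a second nonconstant monomial, of degree j, comparing it with the
    leading one gives a^(n - j) = 1. If P = c ('X + t)^n + q0, every scaling is
    a symmetry; but V, being a symmetry too, fixes - t, and it also fixes
    the critical value q0. These are different points, as P is not conjugate to
    'X^n, so V is the identity and a^n = 1. This is why V is required to be a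
    symmetry of P as well. *)
Lemma symmetry_root_of_unity P : (2 < size P)%N ->
    (forall n (A : {poly F}), size A = 2 -> A \Po P <> 'X^n \Po A) ->
  exists t k, (0 < k)%N /\ forall K V W,
    size K = 2 -> size V = 2 -> size W = 2 ->
    P \Po K = V \Po P -> P \Po V = W \Po P ->
  exists2 a, a ^+ k = 1 & K = a *: ('X + t%:P) - t%:P.
Proof.
move=> sP nP.
have [n n1 sPn] : exists2 n, (1 < n)%N & size P = n.+1.
  by exists (size P).-1; lia.
have [t [L [EP sL]]] := depressed_form sPn (ltnW n1).
move: EP; set c := lead_coef P => EP.
have c0 : c != 0 by rewrite lead_coef_eq0 -size_poly_gt0; lia.
have [Q QP] : exists Q : {poly F}, P = Q \Po ('X + t%:P).
  exists (P \Po ('X - t%:P)).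
  by rewrite -comp_polyA comp_polyB comp_polyX comp_polyC addrK comp_polyXr.
have sQ : size Q = n.+1 by rewrite -sPn QP size_comp_poly2 ?size_XaddC.
have lQ : Q`_n = c.
  rewrite /c QP lead_coef_comp ?size_XaddC // lead_coefXaddC expr1n mulr1.
  by rewrite lead_coefE sQ.
have sym a V : P \Po (a *: ('X + t%:P) - t%:P) = V \Po P ->
    Q \Po (a *: 'X) = V \Po Q.
  move=> E; have st : (1 < size ('X + t%:P : {poly F})%R)%N by rewrite size_XaddC.
  apply: (comp_poly_inj st).
  rewrite -!comp_polyA -QP -E comp_polyZ comp_polyX.
  by rewrite QP -comp_polyA comp_polyD comp_polyX comp_polyC subrK.
have coefV v w (p : {poly F}) j : (0 < j)%N ->
    ((v *: 'X + w%:P) \Po p)`_j = v * p`_j.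
  move=> j0; rewrite comp_polyD comp_polyZ comp_polyX comp_polyC.
  by rewrite coefD coefZ coefC (gtn_eqF j0) addr0.
exists t.
have [/existsP[j /andP[j0 qj]]|noj] :=
  boolP [exists j : 'I_n, (0 < j)%N && (Q`_j != 0)].
  exists (n - j)%N; split=> [|K V W sK sV sW E1 _]; first by rewrite subn_gt0.
  have [a a0 EK] := symmetry_center c0 n1 EP sL sK sV E1.
  exists a => //; move: E1; rewrite EK => /sym E1.
  have [v [w [v0 EV]]] := affineP sV.
  have E i : (0 < i)%N -> Q`_i != 0 -> a ^+ i = v.
    move=> i0 qi; apply: (mulfI qi).
    by rewrite -coef_comp_scaleX E1 EV coefV // mulrC.
  have an : a ^+ n = v by apply: E; rewrite ?lQ // (ltn_trans _ n1).
  apply: (mulIf (expf_neq0 j a0)).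
  by rewrite -exprD subnK ?(ltnW (ltn_ord j)) // mul1r an E.
have EQ : Q = c *: 'X^n + (Q`_0)%:P.
  apply/polyP => i; rewrite coefD coefZ coefXn coefC.
  have [->|i0] := posnP i.
    by rewrite eq_sym gtn_eqF ?(ltn_trans _ n1) // mulr0 add0r.
  rewrite addr0; case: (ltngtP i n) => [lt_in|lt_ni|->]; last by rewrite mulr1.
    rewrite mulr0; apply/eqP; apply: contraNT noj => qi.
    by apply/existsP; exists (Ordinal lt_in); rewrite i0.
  by rewrite mulr0 nth_default // sQ.
have q0t : Q`_0 + t != 0.
  apply/eqP => q0t.
  (* Scaling by an (n - 1)-th root of c conjugates P to 'X^n. *)
  pose l := (n.-1).-root c.
  have lc : l ^+ n.-1 = c by rewrite rootCK //; lia.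
  have l0 : l != 0.
    apply: contraNneq c0 => l0; rewrite -lc l0 expr0n.
    by case: n n1 {sPn EP sL sQ lQ noj EQ l lc l0} => [|[]].
  apply: (nP n (l *: ('X + t%:P))); first by rewrite size_scale ?size_XaddC.
  rewrite comp_polyZ comp_polyD comp_polyX comp_polyC comp_polyXe comp_polyX.
  rewrite QP {1}EQ comp_polyD comp_polyZ comp_polyXe comp_polyX comp_polyC.
  rewrite -addrA -polyCD q0t addr0 scalerA exprZn -lc -exprS prednK //.
  exact: ltnW.
exists n; split=> [|K V W sK sV sW E1 E2]; first exact: ltnW.
have [a a0 EK] := symmetry_center c0 n1 EP sL sK sV E1.
have [v v0 EV] := symmetry_center c0 n1 EP sL sV sW E2.
exists a => //; move: E1; rewrite EK => /sym E1.
have v1 : v = 1.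
  have := congr1 (fun p : {poly F} => p.[0]) E1.
  rewrite !horner_comp hornerZ hornerX mulr0 horner_coef0 EV.
  rewrite !(hornerD, hornerZ, hornerN, hornerX, hornerC) => /eqP.
  rewrite -subr_eq opprK => /eqP.
  rewrite -[X in X = _]mul1r => /(mulIf q0t) //.
have := congr1 (fun p : {poly F} => p`_n) E1.
rewrite EV v1 scale1r addrK comp_polyX coef_comp_scaleX lQ.
by rewrite -[RHS]mulr1 => /(mulfI c0).
Qed.

Lemma finite_symmetries P : (2 < size P)%N ->
    (forall n (A : {poly F}), size A = 2 -> A \Po P <> 'X^n \Po A) ->
  exists Ks : seq {poly F}, forall K V W,
    size K = 2 -> size V = 2 -> size W = 2 ->
    P \Po K = V \Po P -> P \Po V = W \Po P -> K \in Ks.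
Proof.
move=> sP nP; have [t [k [k0 symP]]] := symmetry_root_of_unity sP nP.
have [rs Ers] := closed_field_poly_normal ('X^k - 1 : {poly F}).
exists [seq a *: ('X + t%:P) - t%:P | a <- rs] => K V W sK sV sW E1 E2.
have [a ak ->] := symP K V W sK sV sW E1 E2.
apply: (map_f (fun a => a *: ('X + t%:P) - t%:P)).
have : root ('X^k - 1) a by rewrite rootE hornerD hornerN hornerXn hornerC ak subrr.
rewrite Ers rootZ ?root_prod_XsubC //.
by rewrite lead_coef_eq0 -size_poly_eq0 size_XnsubC.
Qed.
End Symmetries.

(** * Free subsemigroups and common left multiples *)

Definition common_left_multiples (S : semigroupType) :=
  forall a b : S, exists x y, (x * a = y * b)%g.

Definition common_right_multiples (S : semigroupType) :=
  forall a b : S, exists x y, (a * x = b * y)%g.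

Definition right_cancellative (S : semigroupType) :=
  forall a b c : S, (b * a = c * a)%g -> b = c.

Section WordEval.
Variables (X : choiceType) (S : semigroupType) (g : X -> S).

(** Starting from a prefix s gives a value to the empty word, which is not in
    the free semigroup, so that inductions can start there. *)
Definition eval_from (s : S) (w : seq X) := foldl (fun s i => s * g i)%g s w.

Lemma eval_from_mul s t w : eval_from (s * t)%g w = (s * eval_from t w)%g.
Proof. by elim: w t => //= i w IH t; rewrite -IH mulgA. Qed.

Definition eval_word (w : free_semigroup X) : S :=
  match w with
  | @FreeWord _ [::] w0 => False_rect S (elimN eqP w0 erefl)
  | @FreeWord _ (i :: s) _ => eval_from (g i) s
  end.

Lemma eval_wordM : {morph eval_word : u v / (u * v)%g >-> (u * v)%g}.
Proof.
move=> [[|i u] u0] [[|j v] v0] //=; rewrite -?eval_from_mul //.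
by rewrite /eval_from foldl_cat.
Qed.

HB.instance Definition _ := isMultiplicative.Build _ _ eval_word eval_wordM.

Lemma eval_word_head z w : eval_from z (word w) = (z * eval_word w)%g.
Proof. by case: w => -[|i w] w0 //=; rewrite eval_from_mul. Qed.

Hypothesis cancel_S : right_cancellative S.
Hypothesis disjoint_g : forall i j x y, (x * g i = y * g j)%g -> i = j.

(** The last letter of a word can be read off its value, since the left ideals
    S g(i) are disjoint; it is then removed by right cancellation. A nonempty
    word cannot act as a right identity: its value would put every element in
    the left ideal of its last letter, and there is another letter. *)
Lemma eval_from_inj (i1 i2 : X) u v : i1 != i2 ->
  (forall z, eval_from z u = eval_from z v) -> u = v.
Proof.
move=> i12; have rconsE z w j : eval_from z (rcons w j) = (eval_from z w * g j)%g.
  by rewrite /eval_from -cats1 foldl_cat.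
have no_id w j : ~ forall z, z = eval_from z (rcons w j).
  move=> E; have [i /eqP[]] : exists i, i != j.
    by have [<-|] := eqVneq i1 j; [exists i2; rewrite eq_sym|exists i1].
  by have := E (g i * g i)%g; rewrite rconsE; exact: disjoint_g.
elim/last_ind: u v => [|u i IH] v.
  by case/lastP: v => // v j /no_id.
case/lastP: v => [E|v j E]; first by case: (no_id u i) => z; rewrite E.
have ij : i = j by have := E (g i1); rewrite !rconsE; exact: disjoint_g.
rewrite -ij in E *; congr rcons; apply: IH => z.
by apply: (cancel_S (a := g i)); rewrite -!rconsE E.
Qed.

Lemma eval_word_inj (i1 i2 : X) : i1 != i2 -> injective eval_word.
Proof.
move=> i12 u v E; apply/val_inj/(eval_from_inj i12) => z.
by rewrite !eval_word_head E.
Qed.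

End WordEval.

Lemma no_free_common_left_multiples (S : semigroupType) :
  right_cancellative S -> ~ contains_free 2 S -> common_left_multiples S.
Proof.
move=> cS nfree a b; apply: contrapT => nab; apply: nfree.
pose g (i : 'I_2) := if i == ord0 then a else b.
exists (eval_word g : {multiplicative _ -> _}) => /=.
apply: (@eval_word_inj _ _ g cS _ ord0 ord_max) => // i j x y.
rewrite /g; have [->|i0] := eqVneq i ord0; have [->|j0] := eqVneq j ord0 => // E.
- by case: nab; exists x, y.
- by case: nab; exists y, x.
- by apply/val_inj; case: i j i0 j0 {E} => -[|[|i]] // ? [[|[|j]]].
Qed.

(** * Semigroups with a multiplicative degree of bounded multiplicity *)

Section BoundedFibers.
Variables (S : semigroupType) (d : S -> nat) (r : nat).
Hypothesis dM : forall x y, d (x * y)%g = (d x * d y)%N.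
Hypothesis d_fiber : forall l : seq S, uniq l ->
  {in l &, forall x y, d x = d y} -> (size l <= r)%N.

(** The r + 1 words with one letter 1 and r letters 0 have distinct values of
    one degree. *)
Lemma bounded_fibers_no_free : ~ contains_free 2 S.
Proof.
move=> [f f_inj].
have letter_neq0 (i : 'I_2) : [:: i] != [::] by [].
have dE w : d (f w) = (\prod_(i <- word w) d (f (FreeWord (letter_neq0 i))))%N.
  case: w => -[|i w] w0 //; elim: w i w0 => [|j w IH] i w0 /=.
    by rewrite big_seq1; congr (d (f _)); apply: val_inj.
  rewrite big_cons -(IH j isT) -dM -gmulfM; congr (d (f _)); exact: val_inj.
have W_neq0 i : nseq i ord0 ++ ord_max :: nseq (r - i) ord0 != [::] :> seq 'I_2.
  by case: i.
pose W i := FreeWord (W_neq0 i).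
have WK : cancel W (fun w => index (ord_max : 'I_2) (word w)).
  by move=> i; rewrite /= index_cat mem_nseq andbF size_nseq index_head addn0.
have dW i : (i <= r)%N -> d (f (W i)) = d (f (W 0%N)).
  move=> ir; rewrite !dE /= subn0; apply: perm_big.
  rewrite -[X in perm_eq _ (_ :: nseq X _)](subnKC ir) nseqD.
  by rewrite perm_catC /= perm_cons perm_catC.
suff : (size [seq f (W i) | i <- iota 0 r.+1] <= r)%N.
  by rewrite size_map size_iota ltnn.
apply: d_fiber.
  by rewrite map_inj_uniq ?iota_uniq // => i j /f_inj /(can_inj WK).
move=> _ _ /mapP[i + ->] /mapP[j + ->]; rewrite !mem_iota !add0n !ltnS /=.
by move=> ir jr; rewrite dW // (dW j).
Qed.

Lemma size_le_fibers (l : seq S) (D : seq nat) : uniq l ->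
  {in l, forall x, d x \in D} -> (size l <= r * size D)%N.
Proof.
elim: D l => [|v D IH] l ul lD.
  by case: l {ul} lD => [|x l] // /(_ x (mem_head _ _)).
rewrite -(count_predC (fun x => d x == v)) mulnS -!size_filter leq_add //.
  apply: d_fiber => [|x y]; first exact: filter_uniq.
  by rewrite !mem_filter => /andP[/eqP -> _] /andP[/eqP -> _].
apply: IH => [|x]; first exact: filter_uniq.
by rewrite mem_filter => /andP[/= /negPf xv /lD]; rewrite inE xv.
Qed.

End BoundedFibers.

(** * Growth of balls *)

Section Growth.
Variables (S : semigroupType) (x0 : S) (g : seq S).

(** Each step multiplies by a generator on either side, so that left and right
    translations by generators both map a ball into the next one. *)
Fixpoint cayley_ball n : seq S :=
  if n is m.+1 then
    undup (cayley_ball m ++ [seq (s * t)%g | s <- g, t <- cayley_ball m] ++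
      [seq (t * s)%g | s <- g, t <- cayley_ball m])
  else [:: x0].

Lemma cayley_ball_uniq n : uniq (cayley_ball n).
Proof. by case: n => //= n; rewrite undup_uniq. Qed.

Lemma sub_cayley_ball n : {subset cayley_ball n <= cayley_ball n.+1}.
Proof. by move=> x xb; rewrite /= mem_undup mem_cat xb. Qed.

Lemma mulg_cayley_ball s n x :
  s \in g -> x \in cayley_ball n -> (s * x)%g \in cayley_ball n.+1.
Proof. by move=> sg xb; rewrite /= mem_undup !mem_cat allpairs_f ?orbT. Qed.

Lemma cayley_ball_mulg s n x :
  s \in g -> x \in cayley_ball n -> (x * s)%g \in cayley_ball n.+1.
Proof.
move=> sg xb; rewrite /= mem_undup !mem_cat.
by rewrite (allpairs_f (fun s t => t * s)%g) ?orbT.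
Qed.

Variables (d : S -> nat) (r : nat).
Hypothesis dM : forall x y, d (x * y)%g = (d x * d y)%N.
Hypothesis d_fiber : forall l : seq S, uniq l ->
  {in l &, forall x y, d x = d y} -> (size l <= r)%N.

(** The degree of an element of the n-th ball is determined by the number of
    uses, at most n, of each generator. *)
Lemma size_cayley_ball n : (size (cayley_ball n) <= r * n.+1 ^ size g)%N.
Proof.
pose D (e : {ffun 'I_(size g) -> 'I_n.+1}) :=
  (d x0 * \prod_i d (tnth (in_tuple g) i) ^ e i)%N.
have -> : (n.+1 ^ size g =
    size [seq D e | e <- enum {: {ffun 'I_(size g) -> 'I_n.+1}}])%N.
  by rewrite size_map -cardE card_ffun !card_ord.
apply: (size_le_fibers d_fiber (cayley_ball_uniq n)) => x xb.
have [e [en ->]] : exists e : 'I_(size g) -> nat, (forall i, e i <= n)%N /\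
    d x = (d x0 * \prod_i d (tnth (in_tuple g) i) ^ e i)%N.
  elim: n x {D} xb => [|n IH] x.
    rewrite inE => /eqP ->; exists (fun=> 0%N); split => //.
    by rewrite big1 ?muln1.
  have step s t : s \in g -> t \in cayley_ball n ->
      exists e : 'I_(size g) -> nat, (forall i, e i <= n.+1)%N /\
      (d s * d t = d x0 * \prod_i d (tnth (in_tuple g) i) ^ e i)%N.
    move=> sg /IH[e [en ->]].
    have sgi : (index s g < size g)%N by rewrite index_mem.
    pose i0 := Ordinal sgi.
    have gi0 : tnth (in_tuple g) i0 = s by rewrite (tnth_nth s) /= nth_index.
    exists (fun i => (i == i0) + e i)%N; split=> [i|].
      by rewrite -add1n leq_add // ?en //; case: (i == i0).
    rewrite mulnCA; congr (_ * _)%N.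
    rewrite (bigD1 i0) //= [in RHS](bigD1 i0) //= eqxx add1n expnS gi0 mulnA.
    by congr (_ * _)%N; apply: eq_bigr => i /negPf ->.
  rewrite /= mem_undup !mem_cat => /or3P[/IH[e [en ->]]| |].
  - by exists e; split => // i; rewrite leqW.
  - by case/allpairsP => -[s t] /= [sg tb ->]; rewrite dM; exact: step.
  - by case/allpairsP => -[s t] /= [sg tb ->]; rewrite dM mulnC; exact: step.
have -> : (d x0 * \prod_i d (tnth (in_tuple g) i) ^ e i)%N =
    D [ffun i => inord (e i)].
  by congr (_ * _)%N; apply: eq_bigr => i _; rewrite ffunE inordK // ltnS.
by apply: map_f; rewrite mem_enum.
Qed.

End Growth.

(** If every ratio a(n+1) / a(n) exceeded 1 + 1/q, then a would grow
    exponentially. *)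
Lemma polynomial_growth_ratio (a : nat -> nat) r k q : (0 < q)%N ->
  (0 < a 0)%N -> (forall n, a n <= r * n.+1 ^ k)%N ->
  exists n, (q * a n.+1 <= q.+1 * a n)%N.
Proof.
move=> q0 a0 a_le; apply: contrapT => nex.
have lower n : (q.+1 ^ n <= q ^ n * a n)%N.
  elim: n => [|n IH]; first by rewrite !expn0 mul1n.
  have : (q.+1 * a n <= q * a n.+1)%N.
    by apply: ltnW; rewrite ltnNge; apply/negP => ?; apply: nex; exists n.
  move=> le_a; rewrite !expnS; apply: (@leq_trans (q.+1 * (q ^ n * a n))).
    by rewrite leq_mul2l IH.
  by rewrite mulnCA (mulnC q) -mulnA leq_mul2l le_a orbT.
(* This is (1 + 1/q)^m >= 1 + m/q with denominators cleared. *)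
have bernoulli m : (q ^ m * (q + m) <= q * q.+1 ^ m)%N.
  elim: m => [|m IH]; first by rewrite !expn0 addn0 mulnC.
  rewrite !expnS; move: (q ^ m)%N (q.+1 ^ m)%N IH => u v; nia.
(* At n = m (k + 1), the lower bound is at least (1 + m/q)^(k + 1), which has
   degree k + 1 in m, against k for the upper bound. The value of m makes the
   difference of one degree absorb the constants. *)
pose c := (q ^ k.+1 * r * k.+1 ^ k)%N.
pose m := c.+1.
have := lower (m * k.+1)%N; rewrite leqNgt => /negP; apply.
have qk : (0 < q ^ k.+1)%N by rewrite expn_gt0 q0.
rewrite -(ltn_pmul2l qk).
have /leq_trans -> // : (q ^ k.+1 * (q ^ (m * k.+1) * a (m * k.+1)) <
    (q ^ m * (q + m)) ^ k.+1)%N.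
  rewrite mulnCA expnMn -expnM ltn_pmul2l ?expn_gt0 ?q0 //.
  apply: (@leq_ltn_trans (q ^ k.+1 * (r * (k.+1 * (q + m)) ^ k))).
    rewrite leq_mul2l; apply/orP; right; apply: leq_trans (a_le _) _.
    rewrite leq_mul2l; apply/orP; right.
    have [->|k0] := posnP k; first by rewrite !expn0.
    by rewrite leq_exp2r // /m; nia.
  rewrite expnMn !mulnA -/c expnS ltn_mul2r expn_gt0 /m addnS ltn0Sn /=.
  by rewrite ltnS leq_addl.
by rewrite expnM -expnMn leq_exp2r.
Qed.

(** * Means as limits of averages *)

Section LimitMean.
Variables (R : realType) (T : Type).

Definition bounded_real (h : T -> R) := exists b, forall t, `|h t| <= b.

Lemma bounded_realZ a k : bounded_real k -> bounded_real (fun t => a * k t).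
Proof.
by move=> [c kc]; exists (`|a| * c) => t; rewrite normrM ler_wpM2l.
Qed.

Lemma bounded_realD k l :
  bounded_real k -> bounded_real l -> bounded_real (k \+ l).
Proof.
move=> [c kc] [e le]; exists (c + e) => t.
by apply: le_trans (ler_normD _ _) _; rewrite lerD.
Qed.

Lemma bounded_real1 : bounded_real (fun=> 1).
Proof. by exists 1 => t; rewrite normr1. Qed.

Definition average (s : seq T) (h : T -> R) : R :=
  (\sum_(t <- s) h t) / (size s)%:R.

Lemma averageD s h k : average s (h \+ k) = average s h + average s k.
Proof. by rewrite /average big_split mulrDl. Qed.

Lemma averageZ s a h : average s (fun t => a * h t) = a * average s h.
Proof. by rewrite /average -big_distrr mulrA. Qed.

Lemma average_ge0 s h : (forall t, 0 <= h t) -> 0 <= average s h.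
Proof. by move=> h0; rewrite divr_ge0 // sumr_ge0. Qed.

Lemma average1 s : (0 < size s)%N -> average s (fun=> 1) = 1.
Proof.
move=> s0; rewrite /average big_const_seq count_predT iter_addr_0.
by rewrite divff // pnatr_eq0 -lt0n.
Qed.

Lemma norm_average_le s h b :
  0 <= b -> (forall t, `|h t| <= b) -> `|average s h| <= b.
Proof.
move=> b0 hb; have [s0|s0] := posnP (size s).
  by rewrite /average s0 invr0 mulr0 normr0.
have s0' : 0 < (size s)%:R :> R by rewrite ltr0n.
rewrite /average normrM normfV (ger0_norm (ltW s0')) ler_pdivrMr //.
apply: le_trans (ler_norm_sum _ _ _) _.
apply: le_trans (ler_sum _ (fun t _ => hb t)) _.
by rewrite big_const_seq count_predT iter_addr_0 mulr_natr.
Qed.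

(** The functional is total, but only its values on bounded functions are
    meaningful. *)
Record real_mean (m : (T -> R) -> R) : Prop := RealMean {
  real_meanD : forall h k, bounded_real h -> bounded_real k ->
    m (h \+ k) = m h + m k;
  real_meanZ : forall a h, bounded_real h -> m (fun t => a * h t) = a * m h;
  real_mean_ge0 : forall h, bounded_real h -> (forall t, 0 <= h t) -> 0 <= m h;
  real_mean1 : m (fun=> 1) = 1 }.

(** Bounded sequences stay in a compact interval, so they cluster somewhere
    along U, and an ultrafilter converges to its cluster points. *)
Lemma ultrafilter_cvg (U : set_system nat) (u : nat -> R) (b : R) :
  UltraFilter U -> (forall n, `|u n| <= b) -> cvg (u n @[n --> U]).
Proof.
move=> UU ub.
have [|p [_ clp]] := @segment_compact R (- b) b (u n @[n --> U]) _.
  apply: (@filterS _ U _ setT); last exact: filterT.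
  by move=> n _; rewrite /= in_itv /= -ler_norml.
apply/cvg_ex; exists p => B /= Bp.
have [//|UnB] := in_ultra_setVsetC (u @^-1` B) UU.
by have [x [/= nBx Bx]] := clp (~` B) B UnB Bp.
Qed.

Lemma limit_mean (s : nat -> seq T) : (forall n, 0 < size (s n))%N ->
  exists2 m, real_mean m & forall h k, bounded_real h -> bounded_real k ->
    (average (s n) h - average (s n) k @[n --> \oo] --> (0 : R)) -> m h = m k.
Proof.
move=> s0; have [U [UU oo_U]] :=
  ultraFilterLemma (eventually_filter : ProperFilter \oo).
have cv h : bounded_real h -> cvg (average (s n) h @[n --> U]).
  move=> [b hb]; apply: (ultrafilter_cvg (b := `|b|) UU) => n.
  by apply: norm_average_le => // t; apply: le_trans (hb t) (ler_norm b).
exists (fun h => lim (average (s n) h @[n --> U])); first split.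
- move=> h k bh bk; rewrite -limD; [|exact: cv|exact: cv].
  by under eq_fun do rewrite averageD.
- move=> a h bh; apply: cvg_lim => //.
  under eq_fun do rewrite averageZ.
  exact: cvgMl_tmp (cv _ bh).
- move=> h bh h0; apply: limr_ge; first exact: cv.
  by apply: nearW => n; exact: average_ge0.
- apply: cvg_lim => //; under eq_fun do rewrite average1 //; exact: cvg_cst.
move=> h k bh bk hk; apply/eqP; rewrite -subr_eq0 -limB; [|exact: cv|exact: cv].
apply/eqP/cvg_lim => //; apply: cvg_trans hk; exact: cvg_app.
Qed.

Variables (m : (T -> R) -> R) (mP : real_mean m).
Local Notation C := R[i].

(** Positivity applied to b + h and b - h. *)
Lemma real_mean_norm h b : (forall t, `|h t| <= b) -> `|m h| <= b.
Proof.
move=> hb; have bh : bounded_real h by exists b.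
have b1 := bounded_real1.
have key a : a ^+ 2 = 1 -> 0 <= b + a * m h.
  move=> a1; rewrite -[b]mulr1 -(real_mean1 mP) -!(real_meanZ mP) //.
  rewrite -(real_meanD mP); [|exact: bounded_realZ|exact: bounded_realZ].
  apply: (real_mean_ge0 mP) => [|t /=].
    by apply: bounded_realD; exact: bounded_realZ.
  rewrite mulr1 -lerBlDr sub0r; apply: le_trans (hb t).
  have <- : `|- (a * h t)| = `|h t|.
    rewrite normrN normrM (_ : `|a| = 1) ?mul1r //.
    by apply/eqP; rewrite -sqrp_eq1 // -normrX a1 normr1.
  exact: ler_norm.
have := key 1 (expr1n _ _); have := key (-1) (sqrr_sign _ 1%N).
by rewrite ler_norml; lra.
Qed.

Lemma bounded_Re (f : Linf R T) : bounded_real (fun t => complex.Re (f t)).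
Proof.
have [M fM] := Linf_bound f; exists (complex.Re M) => t.
have := le_trans (normc_ge_Re (f t)) (fM t).
by case: M {fM} => x y /=; rewrite lecE /= => /andP[].
Qed.

Lemma normc_real (x : R) : `|x%:C%C : C| = `|x|%:C%C.
Proof. by rewrite normc_def /= expr0n addr0 sqrtr_sqr. Qed.

Lemma normc_i : `|'i%C : C| = 1.
Proof. by rewrite normc_def /= expr0n add0r expr1n sqrtr1. Qed.

Lemma normc_ge_Im (x : C) : `|complex.Im x|%:C%C <= `|x|.
Proof.
by have := normc_ge_Re (x * 'i%C); rewrite ReiNIm normrN normrM normc_i mulr1.
Qed.

Lemma bounded_Im (f : Linf R T) : bounded_real (fun t => complex.Im (f t)).
Proof.
have [M fM] := Linf_bound f; exists (complex.Re M) => t.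
have := le_trans (normc_ge_Im (f t)) (fM t).
by case: M {fM} => x y /=; rewrite lecE /= => /andP[].
Qed.

Definition complex_mean (f : Linf R T) : C^o :=
  (m (fun t => complex.Re (f t)) +i* m (fun t => complex.Im (f t)))%C.

Lemma complex_mean_is_linear : linear complex_mean.
Proof.
have lin a b h k l : bounded_real h -> bounded_real k -> bounded_real l ->
    m (fun t => a * h t + b * k t + l t) = a * m h + b * m k + m l.
  move=> bh bk bl; have bZ c i := @bounded_realZ c i.
  by rewrite -(real_meanZ mP a bh) -(real_meanZ mP b bk) -!(real_meanD mP);
    do ?apply: bounded_realD; auto.
move=> [a b] f g; apply/eqP; rewrite eq_complex /=; apply/andP; split; apply/eqP.
- rewrite -mulNr -lin; [|exact: bounded_Re|exact: bounded_Im|exact: bounded_Re].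
  congr m; apply/funext => t /=.
  transitivity (complex.Re ((a +i* b)%C * (f t : C) + g t)); first by [].
  by case: (f t) (g t) => x y [z w] /=; rewrite mulNr.
- rewrite -lin; [|exact: bounded_Im|exact: bounded_Re|exact: bounded_Im].
  congr m; apply/funext => t /=.
  transitivity (complex.Im ((a +i* b)%C * (f t : C) + g t)); first by [].
  by case: (f t) (g t) => x y [z w].
Qed.

HB.instance Definition _ := GRing.isLinear.Build C (Linf R T) C^o _
  complex_mean complex_mean_is_linear.

Lemma complex_mean_is_mean : is_mean complex_mean.
Proof.
split.
- apply/linear_bounded_continuous/linear_boundedP.
  exists 2; split=> [|r r2 f]; first exact: realn.
  apply: (@le_trans _ _ (2 * `|f|)); last by rewrite ler_wpM2r // ltW.
  have fRe : `|f| = (complex.Re `|f|)%:C%C by [].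
  have bRe t : `|complex.Re (f t)| <= complex.Re `|f|.
    by rewrite -lecR -fRe (le_trans (normc_ge_Re _)) // Linf_le_norm.
  have bIm t : `|complex.Im (f t)| <= complex.Re `|f|.
    by rewrite -lecR -fRe (le_trans (normc_ge_Im _)) // Linf_le_norm.
  rewrite [X in `|X|]complexE (le_trans (ler_normD _ _)) //.
  rewrite mulr_natl mulr2n lerD //.
    by rewrite fRe normc_real lecR real_mean_norm.
  by rewrite normrM normc_i mul1r fRe normc_real lecR real_mean_norm.
- move=> f f0; rewrite lecE /=.
  have fE t : f t = (complex.Re (f t))%:C%C /\ 0 <= complex.Re (f t).
    have := f0 t; rewrite lecE /= => /andP[/eqP im re]; split=> //.
    by case: (f t) im => x y /= ->.
  rewrite (_ : (fun t => complex.Im (f t)) = (fun t => 0 * complex.Re (f t))).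
    rewrite (real_meanZ mP); last exact: bounded_Re.
    rewrite mul0r eqxx /=; apply: (real_mean_ge0 mP) => [|t]; first exact: bounded_Re.
    by have [] := fE t.
  by apply/funext => t; rewrite mul0r; have [-> _] := fE t.
- apply/eqP; rewrite eq_complex /= (real_mean1 mP) eqxx /=.
  by have := real_meanZ mP 0 bounded_real1; rewrite !mul0r => ->.
Qed.

Lemma complexification : exists2 M : {linear Linf R T -> C^o},
  is_mean M & forall f, M f = complex_mean f.
Proof. by exists complex_mean => //; exact: complex_mean_is_mean. Qed.

End LimitMean.

(** * Invariant means and common multiples *)

(** If A and B were disjoint, 1 - 1_A - 1_B would be a nonnegative function of
    mean -1. *)
Lemma mean_meet (R : realType) (T : Type) (M : {linear Linf R T -> (R[i])^o})
    (A B : set T) (f g : Linf R T) : is_mean M ->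
  (forall t, f t = (\1_A t)%:C%C) -> (forall t, g t = (\1_B t)%:C%C) ->
  M f = 1 -> M g = 1 -> A `&` B !=set0.
Proof.
move=> [_ M0 M1] fA gB Mf Mg; apply/set0P/eqP => AB0.
suff : 0 <= M (Linf_cst T 1 - f - g) :> R[i].
  by rewrite !raddfB /= M1 Mf Mg subrr sub0r oppr_ge0 ler10.
apply: M0 => t; suff : 0 <= (1 - \1_A t - \1_B t)%:C%C :> R[i].
  by rewrite !rmorphB /= -fA -gB.
rewrite lecR !indicE.
have [tA|_] := boolP (t \in A); have [tB|_] := boolP (t \in B); rewrite /=; try lra.
by have : (A `&` B) t; [split; exact/set_mem|rewrite AB0].
Qed.

Section Reversible.
Variables (R : realType) (S : semigroupType).

Lemma indic_bounded (A : set S) :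
  ((fun t => (\1_A t : R)%:C%C) : S -> (R[i])^o) \in @bounded_pred R S.
Proof.
apply/Defs.bounded_funP; exists 1 => t; rewrite indicE.
by case: (_ \in _); rewrite ?normr1 ?normr0.
Qed.

(** The right translate by c of the indicator of the left ideal S c is the
    constant 1, so every S c has mass 1. *)
Lemma RIM_common_left_multiples : @RIM R S !=set0 -> common_left_multiples S.
Proof.
move=> [M [Mm Minv]] a b.
pose I (c : S) := [set t : S | exists x, t = x * c]%g.
pose L c := MkLinf (indic_bounded (I c)).
have ML c : M (L c) = 1.
  have [_ _ <-] := Mm; rewrite -(Minv c); congr (M _); apply/val_inj/funext => t.
  by rewrite /= indicE mem_set //; exists t.
have [t [[x tx] [y ty]]] := mean_meet (A := I a) (B := I b) Mm
  (fun t => erefl (L a t)) (fun t => erefl (L b t)) (ML a) (ML b).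
by exists x, y; rewrite -tx.
Qed.

Lemma LIM_common_right_multiples : @LIM R S !=set0 -> common_right_multiples S.
Proof.
move=> [M [Mm Minv]] a b.
pose I (c : S) := [set t : S | exists x, t = c * x]%g.
pose L c := MkLinf (indic_bounded (I c)).
have ML c : M (L c) = 1.
  have [_ _ <-] := Mm; rewrite -(Minv c); congr (M _); apply/val_inj/funext => t.
  by rewrite /= indicE mem_set //; exists t.
have [t [[x tx] [y ty]]] := mean_meet (A := I a) (B := I b) Mm
  (fun t => erefl (L a t)) (fun t => erefl (L b t)) (ML a) (ML b).
by exists x, y; rewrite -tx.
Qed.

End Reversible.

(** * Amenability from almost invariant balls *)

Section Folner.
Variable R : realType.

Lemma sum_subset_le (T : eqType) (A B : seq T) (h : T -> R) b :
  uniq A -> uniq B -> {subset A <= B} -> (forall t, `|h t| <= b) ->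
  `|\sum_(t <- B) h t - \sum_(t <- A) h t| <= b * ((size B)%:R - (size A)%:R).
Proof.
move=> uA uB AB hb.
have pB : perm_eq B (A ++ [seq t <- B | t \notin A]).
  apply: uniq_perm => //.
    rewrite cat_uniq uA filter_uniq // andbT -all_predC.
    by apply/allP => t; rewrite mem_filter /= => /andP[].
  move=> t; rewrite mem_cat mem_filter.
  by have [/AB ->|] := boolP (t \in A).
rewrite (perm_big _ pB) (perm_size pB) big_cat size_cat natrD /=.
rewrite ![_ + _ - _]addrAC !subrr !add0r mulr_natr.
apply: le_trans (ler_norm_sum _ _ _) _.
apply: le_trans (ler_sum _ (fun t _ => hb t)) _.
by rewrite big_const_seq count_predT iter_addr_0.
Qed.

(** A and its image under f have the same size and both lie in B, so each sum
    differs from the sum over B by at most b times the difference of the sizes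
    of B and A. *)
Lemma average_comp_le (T : eqType) (A B : seq T) (f : T -> T) (h : T -> R) b q :
  uniq A -> uniq B -> (0 < size A)%N -> injective f ->
  {subset A <= B} -> {in A, forall t, f t \in B} ->
  (q.+1 * size B <= q.+2 * size A)%N -> (forall t, `|h t| <= b) ->
  `|average A (h \o f) - average A h| <= 2 * b * q.+1%:R^-1.
Proof.
move=> uA uB A0 f_inj AB fAB qAB hb.
have b0 : 0 <= b.
  by case: A A0 {uA AB fAB qAB} => // t A _; apply: le_trans (hb t).
have A0' : 0 < (size A)%:R :> R by rewrite ltr0n.
have q0 : 0 < q.+1%:R :> R by rewrite ltr0n.
rewrite /average -mulrBl normrM normfV (ger0_norm (ltW A0')) ler_pdivrMr //.
have fA : \sum_(t <- A) (h \o f) t = \sum_(t <- map f A) h t by rewrite big_map.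
have := sum_subset_le uA uB AB hb.
have ufA : uniq (map f A) by rewrite map_inj_uniq.
have fAB' : {subset map f A <= B} by move=> _ /mapP[t tA ->]; exact: fAB.
have := sum_subset_le ufA uB fAB' hb.
rewrite size_map fA => le1 le2.
have : `|\sum_(t <- map f A) h t - \sum_(t <- A) h t| <=
    2 * (b * ((size B)%:R - (size A)%:R)).
  rewrite mulr2n mulrDl !mul1r.
  rewrite -(subrKA (\sum_(t <- B) h t)) (le_trans (ler_normD _ _)) //.
  by rewrite distrC lerD.
move=> /le_trans; apply; rewrite -!mulrA ler_pM2l // ler_wpM2l //.
rewrite ler_pdivlMl //.
have : q.+1%:R * (size B)%:R <= q.+2%:R * (size A)%:R :> R.
  by rewrite -!natrM ler_nat.
by rewrite -(@natr1 _ q.+1); move: (q.+1%:R : R) => c; lra.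
Qed.

(** The n-th averaging set is a ball on the first n elements of S, chosen so
    that the next ball is at most (n + 2)/(n + 1) times as large. *)
Lemma folner_amenable (S : semigroupType) (d : S -> nat) (r : nat)
    (e : nat -> S) :
  (forall x y, d (x * y)%g = (d x * d y)%N) ->
  (forall l : seq S, uniq l ->
    {in l &, forall x y, d x = d y} -> (size l <= r)%N) ->
  (forall x, exists n, e n = x) -> cancellative S -> amenable R S.
Proof.
move=> dM d_fiber e_surj cS.
pose g n := [seq e i | i <- iota 0 n].
pose B n := cayley_ball (e 0) (g n).
have ratio n : exists N, (n.+1 * size (B n N.+1) <= n.+2 * size (B n N))%N.
  apply: (@polynomial_growth_ratio _ r (size (g n))) => // k.
  exact: size_cayley_ball.
have [N ratioN] := choice ratio.
have ball_gt0 n k : (0 < size (B n k))%N.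
  suff : e 0 \in B n k by case: (B n k).
  by elim: k => [|k IH]; [rewrite mem_head|exact: sub_cayley_ball].
have [m mP m_inv] :=
  @limit_mean R S (fun n => B n (N n)) (fun n => ball_gt0 n (N n)).
have inv (f : S -> S) i (h : S -> R) : injective f ->
    (forall n t, (i < n)%N -> t \in B n (N n) -> f t \in B n (N n).+1) ->
    bounded_real h -> m (h \o f) = m h.
  move=> f_inj fB [b hb]; apply: m_inv; [by exists b => t; exact: hb|by exists b|].
  apply/norm_cvg0P.
  have lim0 : (fun n => 2 * b * harmonic n) @ \oo --> (0 : R).
    by rewrite -[X in _ --> X](mulr0 (2 * b)); apply: cvgMl_tmp; exact: cvg_harmonic.
  apply: (squeeze_cvgr _ (cvg_cst 0) lim0); near=> n.
  rewrite normr_ge0 /=.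
  apply: average_comp_le (ratioN n) hb => //; try exact: cayley_ball_uniq.
    exact: sub_cayley_ball.
  by move=> t; apply: fB; near: n; exact: nbhs_infty_gt.
have eg i n : (i < n)%N -> e i \in g n.
  by move=> lt_in; apply: map_f; rewrite mem_iota.
have [M M_mean ME] := complexification mP.
have M_inv (f : S -> S) i (h k : Linf R S) : injective f ->
    (forall n t, (i < n)%N -> t \in B n (N n) -> f t \in B n (N n).+1) ->
    (forall t, k t = h (f t)) -> M k = M h.
  move=> f_inj fB kE; rewrite !ME /complex_mean.
  have -> : Linf_fun k = h \o f by apply/funext.
  rewrite -(inv f i _ f_inj fB (bounded_Re h)).
  by rewrite -(inv f i _ f_inj fB (bounded_Im h)).
exists M; split; split=> // s h; have [i <-] := e_surj s.
  apply: (M_inv (fun t => t * e i)%g i) => [t u|n t /eg ei tB|//].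
    by have [_] := cS (e i) t u; apply.
  exact: cayley_ball_mulg.
apply: (M_inv (fun t => e i * t)%g i) => [t u|n t /eg ei tB|//].
  by have [+ _] := cS (e i) t u; apply.
exact: mulg_cayley_ball.
Unshelve. all: by end_near.
Qed.

End Folner.

(** * Semigroups of polynomials *)

Section PolynomialSemigroups.
Variables (R : realType) (S : poly_semigroup R).
Local Notation C := R[i].
Implicit Types x y a b c : psg_elt S.

Lemma size_psg x : (1 < size (val x))%N.
Proof. by apply/psg_nonconstant/set_mem/valP. Qed.

Lemma psg_right_cancellative : right_cancellative (psg_elt S).
Proof.
move=> a b c /(congr1 val) /= E; apply: val_inj.
exact: comp_poly_inj (size_psg a) _ _ E.
Qed.

Definition psg_degree x := (size (val x)).-1.

Lemma psg_degreeM x y : psg_degree (x * y)%g = (psg_degree x * psg_degree y)%N.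
Proof. exact: size_comp_poly. Qed.

Lemma psg_same_degree x y : common_left_multiples (psg_elt S) ->
  psg_degree x = psg_degree y ->
  exists2 K : {poly C}, size K = 2 & val y = K \Po val x.
Proof.
move=> clm dxy; have [a [b /(congr1 val) /= E]] := clm x y.
apply: left_multiple_affine E; [exact: size_psg| |exact: size_psg].
move: dxy (size_psg x) (size_psg y); rewrite /psg_degree.
by case: (size _) => // u; case: (size _) => // v /= ->.
Qed.

(** The pairs (P o x, P o y) and (P o P o x, P o P o y) also have equal degrees,
    which makes K, and the affine map V that it induces, symmetries of P. *)
Lemma psg_finite_symmetries : nonexceptional S ->
  common_left_multiples (psg_elt S) ->
  exists Ks : seq {poly C}, forall x y, psg_degree x = psg_degree y ->
    exists2 K, K \in Ks & val y = K \Po val x.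
Proof.
move=> [P SP nexc] clm.
have sP : (2 < size P)%N.
  by rewrite ltnNge; apply/negP => sP; apply: nexc; constructor 1.
have [|Ks KsP] := finite_symmetries sP.
  by move=> n A sA E; apply: nexc; constructor 2; exists n, A.
exists Ks => x y dxy.
have [K sK yK] := psg_same_degree clm dxy.
pose p : psg_elt S := exist _ P (mem_set SP).
have [|V sV] := psg_same_degree (x := (p * x)%g) (y := (p * y)%g) clm.
  by rewrite !psg_degreeM dxy.
have [|W sW] := psg_same_degree (x := (p * (p * x))%g) (y := (p * (p * y))%g) clm.
  by rewrite !psg_degreeM dxy.
rewrite /= yK => EW EV; exists K => //; apply: (KsP K V W) => //.
  by apply: (comp_poly_inj (size_psg x)); rewrite -!comp_polyA.
apply: (comp_poly_inj (size_psg (p * x)%g)).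
by rewrite /= -[RHS]comp_polyA -EW -[LHS]comp_polyA -EV.
Qed.

Lemma psg_degree_fibers : nonexceptional S ->
  common_left_multiples (psg_elt S) ->
  exists r, forall l : seq (psg_elt S), uniq l ->
    {in l &, forall x y, psg_degree x = psg_degree y} -> (size l <= r)%N.
Proof.
move=> nS clm; have [Ks KsP] := psg_finite_symmetries nS clm.
exists (size Ks) => -[|x l] // ul dl.
rewrite -(size_map val) -(size_map (fun K => K \Po val x) Ks).
apply: uniq_leq_size; first by rewrite map_inj_uniq //; exact: val_inj.
move=> _ /mapP[y yl ->].
have [K KKs ->] := KsP x y (dl _ _ (mem_head _ _) yl).
exact: (map_f (fun K => K \Po val x)).
Qed.

(** Being fixed by K on the right passes to left multiples, so common left
    multiples gather this property for all K in the list. *)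
Lemma psg_fixed_by_symmetries (Ks : seq {poly C}) : psg_elt S ->
  common_left_multiples (psg_elt S) ->
  exists s : psg_elt S, forall K (t : psg_elt S),
    K \in Ks -> val t \Po K = val t -> val s \Po K = val s.
Proof.
move=> s0 clm; elim: Ks => [|K Ks [s sP]]; first by exists s0.
have [[t tK]|nK] := pselect (exists t : psg_elt S, val t \Po K = val t); last first.
  exists s => L t; rewrite inE => /predU1P[->|LKs] tL; last exact: sP tL.
  by case: nK; exists t.
have [u [v uv]] := clm s t.
exists (u * s)%g => L w; rewrite inE => /predU1P[->|LKs] wL.
  by rewrite uv /= -comp_polyA tK.
by rewrite /= -comp_polyA (sP L w).
Qed.

(** Given a b = a c, take x, y with b s x = c s y. Then a b s x = a b s y, so
    y = K o x where K fixes a b s on the right. By choice, s is fixed by K too,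
    hence s x = s y, and cancelling s x on the right leaves b = c. *)
Lemma psg_cancellative : nonexceptional S ->
  common_left_multiples (psg_elt S) -> common_right_multiples (psg_elt S) ->
  cancellative (psg_elt S).
Proof.
move=> nS clm crm a b c; split=> [abc|]; last exact: psg_right_cancellative.
have [Ks KsP] := psg_finite_symmetries nS clm.
have [s sP] := psg_fixed_by_symmetries Ks a clm.
have [x [y bcxy]] := crm (b * s)%g (c * s)%g.
pose t := (a * b * s)%g.
have txy : (t * x = t * y)%g.
  by rewrite /t -!mulgA [in LHS](mulgA b) bcxy -!mulgA !(mulgA a) abc.
have dpos z : (0 < psg_degree z)%N.
  by move: (size_psg z); rewrite /psg_degree; case: (size _) => [|[]].
have dxy : psg_degree x = psg_degree y.
  have := congr1 psg_degree txy; rewrite !psg_degreeM => /eqP.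
  by rewrite eqn_pmul2l ?muln_gt0 ?dpos // => /eqP.
have [K KKs yK] := KsP x y dxy.
have tK : val t \Po K = val t.
  apply: (comp_poly_inj (size_psg x)); rewrite -comp_polyA -yK.
  by have /= := congr1 val txy => ->.
have sxy : (s * x = s * y)%g.
  by apply: val_inj; rewrite /= yK comp_polyA (sP K t).
apply: (psg_right_cancellative (a := (s * x)%g)).
by rewrite mulgA bcxy -mulgA sxy.
Qed.

Lemma psg_enumeration : countable (psg_set S) ->
  exists e : nat -> psg_elt S, forall x, exists n, e n = x.
Proof.
move=> /countable_injP[f f_inj].
have [P SP] := psg_nonempty S.
have [g gK] : exists g : nat -> psg_elt S, forall x, g (f (val x)) = x.
  have /choice : forall n, exists x0 : psg_elt S, forall x, f (val x) = n -> x0 = x.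
    move=> n; have [[x xn]|nx] := pselect (exists x : psg_elt S, f (val x) = n).
      by exists x => y yn; apply/val_inj/f_inj; rewrite ?xn ?yn //; exact: valP.
    by exists (exist _ P (mem_set SP)) => x xn; case: nx; exists x.
  by move=> [g gP]; exists g => x; exact: gP.
by exists g => x; exists (f (val x)).
Qed.

End PolynomialSemigroups.

Theorem corollary8 (R : realType) (S : poly_semigroup R)
    (countable_S : countable (psg_set S)) (nonexceptional_S : nonexceptional S) :
  amenable R (psg_elt S) <->
  (~ contains_free 2 (psg_elt S)) /\ cancellative (psg_elt S).
Proof.
split=> [[M [MR ML]]|[nfree cS]].
  have clm : common_left_multiples (psg_elt S).
    by apply: (RIM_common_left_multiples (R := R)); exists M.
  have crm : common_right_multiples (psg_elt S).
    by apply: (LIM_common_right_multiples (R := R)); exists M.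
  have [r d_fiber] := psg_degree_fibers nonexceptional_S clm.
  split; first exact: (bounded_fibers_no_free (@psg_degreeM _ S) d_fiber).
  exact: psg_cancellative.
have clm := no_free_common_left_multiples (@psg_right_cancellative _ S) nfree.
have [r d_fiber] := psg_degree_fibers nonexceptional_S clm.
have [e e_surj] := psg_enumeration countable_S.
exact: (folner_amenable R (@psg_degreeM _ S) d_fiber e_surj cS).
Qed.
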